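(* Let $(A, d_1, \ldots, d_N)$ be an AssHDer pair of rank $N$ and let $(M, d_1^M, \ldots, d_N^M)$ be a representation of it. Let $Ext(A, M)$ be the set of equivalence classes of abelian extensions of $(A, d_1, \ldots, d_N)$ by $(M, d_1^M, \ldots, d_N^M)$ for which the induced representation of $(A, d_1, \ldots, d_N)$ on $(M, d_1^M, \ldots, d_N^M)$ is the given one. Then there is a one-to-one correspondence $H^2_{\mathrm{AssHDer}}(A, M) \cong Ext(A, M)$.
   Context: All vector spaces and linear maps are over a field $\mathbb{K}$ of characteristic zero. Algebras are associative, not assumed unital. Fix an integer $N \ge 1$. A higher derivation of rank $N$ on an associative algebra $A$ is a sequence $\{d_1, \ldots, d_N\}$ of linear maps $A \to A$ with $d_k(ab) = \sum_{i+j=k} d_i(a) d_j(b)$ for $1 \le k \le N$, $a,b\in A$, where $i,j\ge 0$ and $d_0 = \mathrm{id}_A$. An AssHDer pair of rank $N$ is a tuple $(A, d_1, \ldots, d_N)$ of an associative algebra and a higher derivation of rank $N$ on it. A morphism $(A, d_1, \ldots, d_N) \to (A', d_1', \ldots, d_N')$ is an algebra morphism $f: A \to A'$ with $d_k' \circ f = f \circ d_k$ for all $1\le k\le N$. A representation of $(A, d_1, \ldots, d_N)$ is a tuple $(M, d_1^M, \ldots, d_N^M)$ where $M$ is an $A$-bimodule and $d_k^M : M \to M$ are linear with $d_k^M(am) = \sum_{i+j=k} d_i(a) d_j^M(m)$ and $d_k^M(ma) = \sum_{i+j=k} d_i^M(m) d_j(a)$ for $1\le k \le N$ (with $d_0 =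 \mathrm{id}_A$, $d_0^M = \mathrm{id}_M$). Cohomology. For $f \in \mathrm{Hom}(A^{\otimes n}, M)$, $n\ge 1$, $\delta_{\mathrm{Hoch}} f \in \mathrm{Hom}(A^{\otimes n+1}, M)$ is the Hochschild coboundary $(\delta_{\mathrm{Hoch}} f)(a_1, \ldots, a_{n+1}) = a_1 f(a_2, \ldots, a_{n+1}) + \sum_{i=1}^n (-1)^i f(a_1, \ldots, a_i a_{i+1}, \ldots, a_{n+1}) + (-1)^{n+1} f(a_1, \ldots, a_n) a_{n+1}$, and $\delta_k f = \sum_{i_1 + \cdots + i_n = k,\ i_l\ge 0} f \circ (d_{i_1} \otimes \cdots \otimes d_{i_n}) - d_k^M \circ f \in \mathrm{Hom}(A^{\otimes n}, M)$ for $1\le k\le N$. For a tuple $(f_1, \ldots, f_N)$ in $\mathrm{Hom}(A^{\otimes n}, M)$ and $1\le k\le N$, $\delta'_{\mathrm{Hoch}}(f_k)(a_1, \ldots, a_{n+1}) = \sum_{i+j=k,\ i \ge 0,\ j \ge 1} d_i(a_1) f_j(a_2, \ldots, a_{n+1}) + \sum_{i=1}^n (-1)^i f_k(a_1, \ldots, a_i a_{i+1}, \ldots, a_{n+1}) + (-1)^{n+1} \sum_{i+j=k,\ i \ge 1,\ j \ge 0} f_i(a_1, \ldots, a_n) d_j(a_{n+1})$. Set $C^0_{\mathrm{AssHDer}}(A,M) = 0$, $C^1_{\mathrm{AssHDer}}(A, M) = \mathrm{Hom}(A, M)$, and $C^n_{\mathrm{AssHDer}}(A, M) = \mathrm{Hom}(A^{\otimes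 n}, M) \times \mathrm{Hom}(A^{\otimes n-1}, M)^{N}$ for $n \ge 2$. The differential is $\partial f = (\delta_{\mathrm{Hoch}} f; -\delta_1 f, \ldots, -\delta_N f)$ for $f\in C^1$, and $\partial(f; f_1, \ldots, f_N) = (\delta_{\mathrm{Hoch}} f; \delta'_{\mathrm{Hoch}} f_1 + (-1)^n \delta_1 f, \ldots, \delta'_{\mathrm{Hoch}} f_N + (-1)^n \delta_N f)$ for $(f; f_1, \ldots, f_N) \in C^n$, $n \ge 2$. $H^\ast_{\mathrm{AssHDer}}(A, M)$ is the cohomology of this complex. Abelian extensions. A vector space with linear maps $(M, d_1^M, \ldots, d_N^M)$ is regarded as an AssHDer pair with zero multiplication on $M$. An abelian extension of $(A, d_1, \ldots, d_N)$ by $(M, d_1^M, \ldots, d_N^M)$ is a short exact sequence of AssHDer pairs $0 \to (M, d_1^M, \ldots, d_N^M) \xrightarrow{i} (E, d_1^E, \ldots, d_N^E) \xrightarrow{p} (A, d_1, \ldots, d_N) \to 0$ together with a $\mathbb{K}$-linear splitting $s : A \to E$ of $p$ ($p \circ s = \mathrm{id}_A$). It induces a representation of $(A, d_1, \ldots, d_N)$ on $(M, d_1^M, \ldots, d_N^M)$ by $i(am) = \mu_E(s(a), i(m))$ and $i(ma) = \mu_E(i(m), s(a))$, where $\mu_E$ is the multiplication of $E$; this is independent of $s$. Two abelian extensions $(E, i, p)$ and $(E', i', p')$ are equivalent if there is a morphism of AssHDer pairs $\Psi : E \to E'$ with $\Psi \circ i = i'$ and $p' \circ \Psi = p$. *)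

(* Defs.v *)
From HB Require Import structures.
From mathcomp Require Import all_boot all_order all_algebra.
From mathcomp Require Import boolp functions.

Set Implicit Arguments.
Unset Strict Implicit.
Unset Printing Implicit Defensive.

Import GRing.Theory.
Local Open Scope ring_scope.

Record assAlg (K : fieldType) := AssAlg {
  assAlg_sort :> lmodType K;
  amul : {bilinear assAlg_sort -> assAlg_sort -> assAlg_sort};
  amulA : associative amul
}.
Arguments amul {K a}.

Section HigherDerivations.
Variables (K : fieldType) (N : nat).

(* A sequence d_1, ..., d_N is given as d : 'I_N -> _, so that d k stands for
   d_(k+1).  The extended sequence d_0 = id, d_1, ..., d_N is indexed by
   'I_N.+1, without shift. *)
Definition extd (V : lmodType K) (d : 'I_N -> {linear V -> V})
    (i : 'I_N.+1) : {linear V -> V} :=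
  if unlift ord0 i is Some k then d k else idfun.

Definition higher_derivation (A : assAlg K) (d : 'I_N -> {linear A -> A}) :=
  forall (k : 'I_N) (a b : A),
    d k (amul a b) =
      \sum_(i < N.+1) \sum_(j < N.+1 | (i + j == k.+1)%N)
        amul (extd d i a) (extd d j b).

Record assHDer := AssHDer {
  assHDer_alg :> assAlg K;
  hder : 'I_N -> {linear assHDer_alg -> assHDer_alg};
  hderP : higher_derivation hder
}.
Arguments hder {a}.

Record assHDer_morphism (A B : assHDer) := AssHDerMorphism {
  morph_fun :> {linear A -> B};
  morphM : forall a b, morph_fun (amul a b) = amul (morph_fun a) (morph_fun b);
  morph_hder : forall k a, morph_fun (hder k a) = hder k (morph_fun a)
}.

Record representation (A : assHDer) := Representation {
  rep_sort :> lmodType K;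
  lact : {bilinear A -> rep_sort -> rep_sort};
  ract : {bilinear rep_sort -> A -> rep_sort};
  rder : 'I_N -> {linear rep_sort -> rep_sort};
  lactM : forall a b m, lact (amul a b) m = lact a (lact b m);
  ractM : forall m a b, ract m (amul a b) = ract (ract m a) b;
  lractA : forall a m b, ract (lact a m) b = lact a (ract m b);
  rder_lact : forall (k : 'I_N) a m,
    rder k (lact a m) =
      \sum_(i < N.+1) \sum_(j < N.+1 | (i + j == k.+1)%N)
        lact (extd hder i a) (extd rder j m);
  rder_ract : forall (k : 'I_N) m a,
    rder k (ract m a) =
      \sum_(i < N.+1) \sum_(j < N.+1 | (i + j == k.+1)%N)
        ract (extd rder i m) (extd hder j a)
}.

End HigherDerivations.
Arguments hder {K N a}.
Arguments lact {K N A r}.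
Arguments ract {K N A r}.
Arguments rder {K N A}.

Section Multilinear.
Variables (K : fieldType) (U V : lmodType K) (n : nat).

Definition upd (a : 'I_n -> U) (l : 'I_n) (x : U) : 'I_n -> U :=
  fun j => if j == l then x else a j.

Definition multilinear_prop (f : ('I_n -> U) -> V) :=
  forall (l : 'I_n) (a : 'I_n -> U), linear (fun x => f (upd a l x)).

Definition multilinear : {pred ('I_n -> U) -> V} :=
  fun f => `[< multilinear_prop f >].

Lemma multilinearP f : reflect (multilinear_prop f) (f \in multilinear).
Proof. exact: asboolP. Qed.

Lemma multilinear_submod_closed : submod_closed multilinear.
Proof.
split.
  by apply/multilinearP => l a c x y /=; rewrite scaler0 addr0.
move=> c f g /multilinearP fP /multilinearP gP; apply/multilinearP => l a e x y.
rewrite !fctE /= [f _]fP [g _]gP !scalerDr !scalerA (mulrC c e).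
by rewrite addrACA.
Qed.

HB.instance Definition _ :=
  GRing.isSubmodClosed.Build K (('I_n -> U) -> V) multilinear
    multilinear_submod_closed.

(* Hom(U^{(x) n}, V), in the guise of the n-linear maps U^n -> V *)
Record mlin : Type := MLin {
  mlin_fun :> ('I_n -> U) -> V;
  mlin_funP : mlin_fun \in multilinear
}.

HB.instance Definition _ := [isSub for mlin_fun].
HB.instance Definition _ := [Choice of mlin by <:].
HB.instance Definition _ := [SubChoice_isSubLmodule of mlin by <:].

End Multilinear.
Arguments multilinear {K U V n}.
Arguments multilinearP {K U V n f}.

Lemma addrACA3 (V : zmodType) (x x' y y' z z' : V) :
  x + x' + (y + y') + (z + z') = x + y + z + (x' + y' + z').
Proof. by rewrite (addrACA x) (addrACA (x + y)). Qed.

Section MultilinearClosure.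
Variables (K : fieldType) (U V W : lmodType K).

Lemma multilinear_add n (f g : ('I_n -> U) -> V) :
  f \in multilinear -> g \in multilinear ->
  (fun a => f a + g a) \in multilinear.
Proof. exact: rpredD. Qed.

Lemma multilinear_scale n c (f : ('I_n -> U) -> V) :
  f \in multilinear -> (fun a => c *: f a) \in multilinear.
Proof. exact: rpredZ. Qed.

Lemma multilinear_sum n (I : finType) (P : pred I) (F : I -> ('I_n -> U) -> V) :
  (forall i, F i \in multilinear) ->
  (fun a => \sum_(i | P i) F i a) \in multilinear.
Proof.
move=> FP; rewrite (_ : (fun a => _) = \sum_(i | P i) F i).
  exact: rpred_sum.
by apply/funext => a; rewrite fct_sumE.
Qed.

Lemma multilinear_comp n m (f : mlin U V n) (T : ('I_m -> U) -> 'I_n -> U) :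
  (forall a l, exists l', exists g : {linear U -> U},
     forall x, T (upd a l x) = upd (T a) l' (g x)) ->
  (fun a => f (T a)) \in multilinear.
Proof.
move=> TP; apply/multilinearP => l a c x y.
have [l' [g gP]] := TP a l; rewrite !gP linearP.
exact: (multilinearP (mlin_funP f)).
Qed.

Lemma multilinear_linear n (f : mlin U V n) (g : {linear V -> W}) :
  (fun a => g (f a)) \in multilinear.
Proof.
apply/multilinearP => l a c x y.
by rewrite (multilinearP (mlin_funP f)) linearP.
Qed.

End MultilinearClosure.

Section Complex.
Variables (K : fieldType) (N : nat) (A : assHDer K N) (M : representation A).

Local Notation Hom n := (mlin A M n).

Definition args_tail n (a : 'I_n.+1 -> A) : 'I_n -> A :=
  fun j => a (lift ord0 j).

Definition args_init n (a : 'I_n.+1 -> A) : 'I_n -> A :=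
  fun j => a (widen_ord (leqnSn n) j).

(* (a_0, ..., a_i a_(i+1), ..., a_n), with arguments numbered from 0, whence
   the shifted signs (-1) ^+ i.+1 below *)
Definition args_merge n (i : 'I_n) (a : 'I_n.+1 -> A) : 'I_n -> A :=
  fun j => if (j < i)%N then args_init a j
           else if j == i then amul (args_init a j) (args_tail a j)
           else args_tail a j.

Lemma args_tail_upd0 n (a : 'I_n.+1 -> A) x :
  args_tail (upd a ord0 x) = args_tail a.
Proof. by apply/funext => j; rewrite /args_tail /upd eq_sym (negbTE (neq_lift _ _)). Qed.

Lemma args_tail_updS n (a : 'I_n.+1 -> A) l x :
  args_tail (upd a (lift ord0 l) x) = upd (args_tail a) l x.
Proof. by apply/funext => j; rewrite /args_tail /upd (inj_eq lift_inj). Qed.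

Lemma widen_ord_inj n : injective (widen_ord (leqnSn n)).
Proof. by move=> i j /(congr1 val) /= ij; apply: val_inj. Qed.

Lemma args_init_upd_max n (a : 'I_n.+1 -> A) x :
  args_init (upd a ord_max x) = args_init a.
Proof.
apply/funext => j; rewrite /args_init /upd -val_eqE /=.
by rewrite ltn_eqF.
Qed.

Lemma args_init_updW n (a : 'I_n.+1 -> A) l x :
  args_init (upd a (widen_ord (leqnSn n) l) x) = upd (args_init a) l x.
Proof.
by apply/funext => j; rewrite /args_init /upd (inj_eq (@widen_ord_inj n)).
Qed.

Lemma ord_max_or_widen n (l : 'I_n.+1) :
  l = ord_max \/ exists l', l = widen_ord (leqnSn n) l'.
Proof.
have [ln|ln] := ltnP l n; first by right; exists (Ordinal ln); apply: val_inj.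
left; apply: val_inj => /=; apply/eqP; rewrite eqn_leq ln andbT.
by rewrite -ltnS.
Qed.

Lemma multilinear_lact n (g : {linear A -> A}) (f : Hom n) :
  (fun a : 'I_n.+1 -> A => lact (g (a ord0)) (f (args_tail a)))
    \in multilinear.
Proof.
apply/multilinearP => l a c x y.
have [l'|] := unliftP ord0 l => ->.
  rewrite !args_tail_updS (multilinearP (mlin_funP f)).
  by rewrite /upd /= linearPr.
by rewrite !args_tail_upd0 /upd eqxx linearP linearPl.
Qed.

Lemma multilinear_ract n (g : {linear A -> A}) (f : Hom n) :
  (fun a : 'I_n.+1 -> A => ract (f (args_init a)) (g (a ord_max)))
    \in multilinear.
Proof.
apply/multilinearP => l a c x y.
have [->|[l' ->]] := ord_max_or_widen l.
  by rewrite !args_init_upd_max /upd eqxx linearP linearPr.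
rewrite !args_init_updW (multilinearP (mlin_funP f)).
by rewrite /upd /= -!val_eqE /= gtn_eqF // linearPl.
Qed.

Lemma multilinear_merge n (i : 'I_n) (f : Hom n) :
  (fun a : 'I_n.+1 -> A => f (args_merge i a)) \in multilinear.
Proof.
apply: multilinear_comp => a l.
have [li|il] := ltnP l i.
  have ln : (l < n)%N by apply: ltn_trans li _.
  exists (Ordinal ln), idfun => x; apply/funext => j.
  rewrite /args_merge /upd /args_init /args_tail -!val_eqE /= /bump leq0n add1n.
  have Sij : (i <= j)%N -> (j.+1 == l) = false.
    by move=> ij; rewrite gtn_eqF // ltnS (leq_trans (ltnW li)).
  have ij : (i <= j)%N -> (j == l :> nat) = false.
    by move=> ij; rewrite gtn_eqF // (leq_trans li).
  by case: ltngtP => // [/ltnW|/esym/eq_leq] h; rewrite Sij // ij.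
move: il; rewrite leq_eqVlt => /predU1P[il|].
  exists i, (applyr amul (args_tail a i)) => x; apply/funext => j.
  rewrite /args_merge /upd /args_init /args_tail -!val_eqE /= /bump leq0n add1n.
  rewrite -il; case: ltngtP => // [ij|ji].
    by rewrite gtn_eqF // ltnS ltnW.
  rewrite gtn_eqF ?ji //=; congr (amul x (a _)); apply: val_inj.
  by rewrite /= /bump !leq0n ji.
rewrite leq_eqVlt => /predU1P[il|il].
  exists i, (amul (args_init a i)) => x; apply/funext => j.
  rewrite /args_merge /upd /args_init /args_tail -!val_eqE /= /bump leq0n add1n.
  rewrite -il eqSS; case: ltngtP => // [ji|ji].
    by rewrite ltn_eqF // ltnS ltnW.
  rewrite ji ltn_eqF //=; congr (amul (a _) x); apply: val_inj.
  by rewrite /= ji.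
have l0 : (0 < l)%N by apply: leq_ltn_trans il.
have ln : (l.-1 < n)%N by rewrite prednK // -ltnS.
exists (Ordinal ln), idfun => x; apply/funext => j.
rewrite /args_merge /upd /args_init /args_tail -!val_eqE /= /bump leq0n add1n.
rewrite -[in j == l.-1 :> nat]eqSS prednK //.
have jl : (j <= i)%N -> (j == l :> nat) = false.
  by move=> ji; rewrite ltn_eqF // (leq_ltn_trans ji) // ltnW.
have Sjl : (j <= i)%N -> (j.+1 == l) = false.
  by move=> ji; rewrite ltn_eqF // (leq_ltn_trans _ il).
by case: ltngtP => // [/ltnW|/eq_leq] h; rewrite Sjl // jl.
Qed.

Fact dHoch_subproof n (f : Hom n) :
  (fun a : 'I_n.+1 -> A =>
     lact (a ord0) (f (args_tail a))
     + \sum_(i < n) (-1) ^+ i.+1 *: f (args_merge i a)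
     + (-1) ^+ n.+1 *: ract (f (args_init a)) (a ord_max)) \in multilinear.
Proof.
apply: multilinear_add; first apply: multilinear_add.
- exact: (multilinear_lact idfun).
- by apply: multilinear_sum => i; apply/multilinear_scale/multilinear_merge.
- exact/multilinear_scale/(multilinear_ract idfun).
Qed.

Definition dHoch n (f : Hom n) : Hom n.+1 := MLin (dHoch_subproof f).

(* This is delta_(k+1); the function w is the tuple (i_1, ..., i_n). *)
Fact delta_subproof (k : 'I_N) n (f : Hom n) :
  (fun a : 'I_n -> A =>
     \sum_(w : {ffun 'I_n -> 'I_N.+1} | (\sum_(l < n) w l == k.+1)%N)
        f (fun l => extd hder (w l) (a l))
     - rder M k (f a)) \in multilinear.
Proof.
apply: rpredB; last exact: multilinear_linear.
apply: multilinear_sum => w; apply: multilinear_comp => a l.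
exists l, (extd hder (w l)) => x; apply/funext => j; rewrite /upd.
by case: eqP => // ->.
Qed.

Definition delta (k : 'I_N) n (f : Hom n) : Hom n := MLin (delta_subproof k f).

(* F k stands for f_(k+1), whence the conditions on i + j. *)
Fact dHoch'_subproof n (F : {ffun 'I_N -> Hom n}) (k : 'I_N) :
  (fun a : 'I_n.+1 -> A =>
     \sum_(i < N.+1) \sum_(j < N | (i + j.+1 == k.+1)%N)
        lact (extd hder i (a ord0)) (F j (args_tail a))
     + \sum_(i < n) (-1) ^+ i.+1 *: F k (args_merge i a)
     + (-1) ^+ n.+1 *: \sum_(i < N) \sum_(j < N.+1 | (i.+1 + j == k.+1)%N)
          ract (F i (args_init a)) (extd hder j (a ord_max))) \in multilinear.
Proof.
apply: multilinear_add; first apply: multilinear_add.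
- by do 2!apply: multilinear_sum => ?; exact: multilinear_lact.
- by apply: multilinear_sum => i; apply/multilinear_scale/multilinear_merge.
- apply: multilinear_scale; do 2!apply: multilinear_sum => ?.
  exact: multilinear_ract.
Qed.

Definition dHoch' n (F : {ffun 'I_N -> Hom n}) (k : 'I_N) : Hom n.+1 :=
  MLin (dHoch'_subproof F k).

Definition cochain (n : nat) : lmodType K :=
  match n with
  | 0 => 'rV[K]_0
  | 1 => Hom 1
  | m.+2 => (Hom m.+2 * {ffun 'I_N -> Hom m.+1})%type
  end.

Definition diff (n : nat) : cochain n -> cochain n.+1 :=
  match n with
  | 0 => fun=> 0
  | 1 => fun f => (dHoch f, [ffun k => - delta k f])
  | m.+2 => fun c =>
      (dHoch c.1, [ffun k => dHoch' c.2 k + (-1) ^+ m.+2 *: delta k c.1])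
  end.

Lemma dHoch_linear n : linear (@dHoch n).
Proof.
move=> c f g; apply: val_inj; apply/funext => a /=.
rewrite !fctE /= !(linearPr, linearPl) !scalerDr !scaler_sumr.
under [X in _ + X + _]eq_bigr => i _ do
  rewrite scalerDr !scalerA (mulrC _ c) -scalerA.
rewrite big_split /= !scalerA (mulrC _ c).
exact: addrACA3.
Qed.

Lemma delta_linear k n : linear (@delta k n).
Proof.
move=> c f g; apply: val_inj; apply/funext => a /=.
rewrite !fctE /= linearP big_split /= -scaler_sumr scalerBr.
by rewrite opprD addrACA.
Qed.

Lemma dHoch'_linear k n : linear (@dHoch' n ^~ k).
Proof.
move=> c f g; apply: val_inj; apply/funext => a /=.
rewrite !fctE /= !scalerDr.
rewrite [X in X + _ + _](_ : _ =
  c *: (\sum_(i < N.+1) \sum_(j < N | (i + j.+1 == k.+1)%N)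
          lact (extd hder i (a ord0)) (f j (args_tail a)))
  + \sum_(i < N.+1) \sum_(j < N | (i + j.+1 == k.+1)%N)
          lact (extd hder i (a ord0)) (g j (args_tail a))); last first.
  rewrite scaler_sumr -big_split; apply: eq_bigr => i _.
  rewrite scaler_sumr -big_split; apply: eq_bigr => j _.
  by rewrite !ffunE /= !fctE /= linearPr.
rewrite [X in _ + X + _](_ : _ =
  c *: (\sum_(i < n) (-1) ^+ i.+1 *: f k (args_merge i a))
  + \sum_(i < n) (-1) ^+ i.+1 *: g k (args_merge i a)); last first.
  rewrite scaler_sumr -big_split; apply: eq_bigr => i _.
  by rewrite !ffunE /= !fctE /= scalerDr !scalerA mulrC.
rewrite [X in _ + _ + _ *: X](_ : _ =
  c *: (\sum_(i < N) \sum_(j < N.+1 | (i.+1 + j == k.+1)%N)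
          ract (f i (args_init a)) (extd hder j (a ord_max)))
  + \sum_(i < N) \sum_(j < N.+1 | (i.+1 + j == k.+1)%N)
          ract (g i (args_init a)) (extd hder j (a ord_max))); last first.
  rewrite scaler_sumr -big_split; apply: eq_bigr => i _.
  rewrite scaler_sumr -big_split; apply: eq_bigr => j _.
  by rewrite !ffunE /= !fctE /= linearPl.
rewrite [(-1) ^+ _ *: (_ + _)]scalerDr !scalerA (mulrC _ c).
exact: addrACA3.
Qed.

Lemma diff_linear n : linear (@diff n).
Proof.
case: n => [|[|n]] c f g /=.
- by rewrite scaler0 addr0.
- congr pair; first exact: dHoch_linear.
  apply/ffunP => k; rewrite !ffunE delta_linear opprD scalerN; congr (_ + _).
- congr pair; first exact: dHoch_linear.
  apply/ffunP => k; rewrite !ffunE delta_linear dHoch'_linear.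
  by rewrite !scalerDr !scalerA (mulrC _ c) addrACA.
Qed.

HB.instance Definition _ n :=
  GRing.isLinear.Build K (cochain n) (cochain n.+1) _ (@diff n) (@diff_linear n).

Definition cocycle n : {pred cochain n} := fun c => diff c == 0.

Lemma cocycle_submod_closed n : submod_closed (@cocycle n).
Proof.
split; first by rewrite unfold_in linear0.
by move=> c f g /eqP f0 /eqP g0; rewrite unfold_in linearP /= f0 g0 scaler0 addr0.
Qed.

HB.instance Definition _ n :=
  GRing.isSubmodClosed.Build K (cochain n) (@cocycle n) (@cocycle_submod_closed n).

Record cocycles n : Type := Cocycles {
  cocycles_val :> cochain n;
  cocyclesP : cocycles_val \in @cocycle n
}.

HB.instance Definition _ n := [isSub for @cocycles_val n].
HB.instance Definition _ n := [Choice of cocycles n by <:].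
HB.instance Definition _ n := [SubChoice_isSubLmodule of cocycles n by <:].

Definition coboundary n : {pred cocycles n} :=
  match n with
  | 0 => fun z => z == 0
  | m.+1 => fun z => `[< exists f : cochain m, val z = diff f >]
  end.

Lemma coboundary_submod_closed n : submod_closed (@coboundary n).
Proof.
case: n => [|n]; split=> [|c f g].
- exact: eqxx.
- by move=> /eqP -> /eqP ->; rewrite scaler0 addr0; exact: eqxx.
- by apply/asboolP; exists 0; rewrite !linear0.
- move=> /asboolP[f' ff'] /asboolP[g' gg']; apply/asboolP.
  exists (c *: f' + g'); have -> : val (c *: f + g) = c *: val f + val g by [].
  by rewrite ff' gg' linearP.
Qed.

HB.instance Definition _ n :=
  GRing.isSubmodClosed.Build K (cocycles n) (@coboundary n)
    (@coboundary_submod_closed n).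

(* Z^n / (Z^n \cap im diff); as diff \o diff = 0, this is Z^n / im diff. *)
Definition cohomology n := Quotient.quot (@coboundary n).

End Complex.

Section TrivialPair.
Variables (K : fieldType) (V : lmodType K).

Definition zero_mul (x y : V) : V := 0.

Lemma zero_mul_bilinear :
  bilinear_for (GRing.Scale.Law.clone _ _ *:%R _)
    (GRing.Scale.Law.clone _ _ *:%R _) zero_mul.
Proof. by split=> z c x y; rewrite /zero_mul /= scaler0 addr0. Qed.

HB.instance Definition _ :=
  bilinear_isBilinear.Build K V V V *:%R *:%R zero_mul zero_mul_bilinear.

Lemma zero_mulA : associative zero_mul. Proof. by []. Qed.

Definition zero_assAlg : assAlg K := AssAlg (amul := zero_mul) zero_mulA.

Variables (N : nat) (d : 'I_N -> {linear V -> V}).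

Lemma zero_hder : @higher_derivation K N zero_assAlg d.
Proof.
by move=> k a b; rewrite linear0 big1 // => i _; rewrite big1.
Qed.

Definition zero_assHDer : assHDer K N := AssHDer zero_hder.

End TrivialPair.

Section Extensions.
Variables (K : fieldType) (N : nat) (A : assHDer K N).

Record abelian_extension (V : lmodType K) (d : 'I_N -> {linear V -> V}) :=
    AbelianExtension {
  ext_pair :> assHDer K N;
  ext_i : assHDer_morphism (zero_assHDer d) ext_pair;
  ext_p : assHDer_morphism ext_pair A;
  ext_i_inj : injective ext_i;
  ext_exact : forall e, ext_p e = 0 <-> exists m, e = ext_i m;
  ext_p_surj : forall a, exists e, ext_p e = a;
  ext_s : {linear A -> ext_pair};
  ext_sK : cancel ext_s ext_p
}.

Variable M : representation A.

Definition induces_rep (E : abelian_extension (rder M)) :=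
  (forall a m, ext_i E (lact a m) = amul (ext_s E a) (ext_i E m)) /\
  (forall m a, ext_i E (ract m a) = amul (ext_i E m) (ext_s E a)).

Record rep_extension := RepExtension {
  rep_ext :> abelian_extension (rder M);
  rep_extP : induces_rep rep_ext
}.

Definition ext_equivalent (E E' : rep_extension) :=
  exists Psi : assHDer_morphism E E',
    (forall m, Psi (ext_i E m) = ext_i E' m) /\
    (forall e, ext_p E' (Psi e) = ext_p E e).

Lemma ext_equivalent_refl E : ext_equivalent E E.
Proof. by exists (@AssHDerMorphism K N E E idfun (fun _ _ => erefl) (fun _ _ => erefl)). Qed.

Lemma ext_equivalent_trans E' E E'' :
  ext_equivalent E E' -> ext_equivalent E' E'' -> ext_equivalent E E''.
Proof.
move=> [f [fi fp]] [g [gi gp]].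
have hM a b : (g \o f) (amul a b) = amul ((g \o f) a) ((g \o f) b).
  by rewrite /= !morphM.
have hd k a : (g \o f) (hder k a) = hder k ((g \o f) a).
  by rewrite /= !morph_hder.
exists (AssHDerMorphism hM hd); split=> [m|e] /=.
  by rewrite fi gi.
by rewrite gp fp.
Qed.

Lemma ext_equivalent_sym E E' : ext_equivalent E E' -> ext_equivalent E' E.
Proof.
move=> [f [fi fp]].
have f_inj : injective f.
  move=> x y /eqP; rewrite -subr_eq0 -linearB => /eqP fxy.
  apply/eqP; rewrite -subr_eq0; apply/eqP.
  have /ext_exact[m xy] : ext_p E (x - y) = 0 by rewrite -fp fxy linear0.
  move: fxy; rewrite xy fi -[X in _ = X](linear0 (ext_i E')) => /ext_i_inj ->.
  exact: linear0.
have f_surj y : exists x, f x = y.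
  have /ext_exact[m ym] : ext_p E' (y - f (ext_s E (ext_p E' y))) = 0.
    by rewrite linearB fp ext_sK subrr.
  exists (ext_s E (ext_p E' y) + ext_i E m).
  by rewrite linearD fi -ym addrC subrK.
have [g gK] := choice f_surj.
have fK : cancel f g by move=> x; apply: f_inj; rewrite gK.
have g_lin : linear g by move=> c x y; apply: f_inj; rewrite linearP !gK.
pose gL : {linear E' -> E} :=
  HB.pack g (GRing.isLinear.Build K E' E _ g g_lin).
have hM a b : gL (amul a b) = amul (gL a) (gL b).
  by apply: f_inj; rewrite morphM !gK.
have hd k a : gL (hder k a) = hder k (gL a).
  by apply: f_inj; rewrite morph_hder !gK.
exists (AssHDerMorphism hM hd); split=> [m|e] /=.
  by rewrite -fi fK.
by rewrite -fp gK.
Qed.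

(* The set of equivalence classes.  As rep_extension lives in a universe above
   that of choiceType, the quotient types of generic_quotient do not apply. *)
Record Ext := ExtClass {
  ext_class :> rep_extension -> Prop;
  ext_classP : exists E, ext_class = ext_equivalent E
}.

End Extensions.

(* Main.v *)
(* A 2-cochain c = (f; f_1, ..., f_N) twists the multiplication and the maps d_k
   of the split extension A (+) M:
     (a, m)(b, n) = (ab, an + mb + f(a, b)),
     d_k (a, m) = (d_k a, d_k^M m + f_k a).
   The cocycle equations for c say exactly that this product is associative and
   that these d_k form a higher derivation.  A morphism of extensions
   between two such twists has the form (a, m) |-> (a, m + g a), and g makes it
   a morphism iff the cocycles differ by the coboundary of g.  Finally, any
   extension (E, i, p) with section s is isomorphic to a twist, through
   (a, m) |-> s a + i m, where f and the f_k measure the failure of s to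
   preserve the products and the d_k. *)
Require Import Defs.
From HB Require Import structures.
From mathcomp Require Import all_boot all_order all_algebra.
From mathcomp Require Import boolp functions.

Set Implicit Arguments.
Unset Strict Implicit.
Unset Printing Implicit Defensive.

Import GRing.Theory.
Local Open Scope ring_scope.

(** * Sums over tuples with one or two entries *)

Section FiniteSums.
Variables (I : finType) (W : nmodType).

Lemma sum_ffun1 (P : pred I) (G : I -> W) :
  \sum_(w : {ffun 'I_1 -> I} | P (w ord0)) G (w ord0) = \sum_(i | P i) G i.
Proof.
rewrite (reindex (fun i => [ffun _ : 'I_1 => i])) /=; last first.
  exists (fun w => w ord0) => [i _|w _]; first by rewrite ffunE.
  by apply/ffunP => i; rewrite ffunE (ord1 i).
by apply: eq_big => [i|i _]; rewrite ffunE.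
Qed.

(** Bridges the tuple sum in [delta], taken in arity 2, and the double sum in [higher_derivation]: a
    function on ['I_2] is the pair of its values. *)
Lemma sum_ffun2 (P : I -> I -> bool) (G : I -> I -> W) :
  \sum_(w : {ffun 'I_2 -> I} | P (w ord0) (w ord_max)) G (w ord0) (w ord_max)
  = \sum_i \sum_(j | P i j) G i j.
Proof.
rewrite pair_big_dep /=.
pose h (p : I * I) := [ffun i : 'I_2 => if i == ord0 then p.1 else p.2].
rewrite (reindex h) /=; last first.
  exists (fun w => (w ord0, w ord_max)) => [[i j] _|w _].
    by rewrite !ffunE.
  apply/ffunP => i; rewrite ffunE; case: eqP => [->//|/eqP i0].
  by congr (w _); apply: val_inj; case: i i0 => [[|[|]]].
by apply: eq_big => [[i j]|[i j] _]; rewrite !ffunE.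
Qed.

Lemma double_sumD (J : finType) (P : I -> pred J) (F G : I -> J -> W) :
  \sum_i \sum_(j | P i j) (F i j + G i j)
  = \sum_i \sum_(j | P i j) F i j + \sum_i \sum_(j | P i j) G i j.
Proof. by rewrite -big_split; apply: eq_bigr => i _; rewrite big_split. Qed.

End FiniteSums.

(** * Linear and bilinear maps as elements of [mlin] in arities 1 and 2 *)

Section SmallArity.
Variables (K : fieldType) (U V : lmodType K).

Lemma mlin_eqP n (f g : mlin U V n) : f = g <-> forall u, f u = g u.
Proof. by split=> [->//|fg]; apply: val_inj; apply/funext. Qed.

Definition args2 (x y : U) : 'I_2 -> U := fun i => if i == ord0 then x else y.

Lemma args2E (a : 'I_2 -> U) : a = args2 (a ord0) (a ord_max).
Proof.
apply/funext => i; rewrite /args2; case: eqP => [->//|/eqP i0].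
by congr (a _); apply: val_inj; case: i i0 => [[|[|]]].
Qed.

Lemma args1E (a : 'I_1 -> U) : a = fun=> a ord0.
Proof. by apply/funext => i; rewrite ord1. Qed.

Lemma upd_args1 (a : 'I_1 -> U) l x : upd a l x = fun=> x.
Proof. by rewrite [LHS]args1E (ord1 l) /upd eqxx. Qed.

Lemma upd_args2l (x y z : U) : upd (args2 x y) ord0 z = args2 z y.
Proof. by rewrite [LHS]args2E. Qed.

Lemma upd_args2r (x y z : U) : upd (args2 x y) ord_max z = args2 x z.
Proof. by rewrite [LHS]args2E. Qed.

Lemma mlin1_linear (f : mlin U V 1) : linear (fun x => f (fun=> x)).
Proof.
(* The base tuple [fun=> 0] is a dummy: [upd] overwrites its only entry. *)
move=> c x y; have := multilinearP (mlin_funP f) ord0 (fun=> 0) c x y.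
by rewrite !upd_args1.
Qed.

Lemma mlin2_linearr (f : mlin U V 2) x : linear (fun y => f (args2 x y)).
Proof.
move=> c y y'; have := multilinearP (mlin_funP f) ord_max (args2 x 0) c y y'.
by rewrite !upd_args2r.
Qed.

Lemma mlin2_linearl (f : mlin U V 2) y : linear (fun x => f (args2 x y)).
Proof.
move=> c x x'; have := multilinearP (mlin_funP f) ord0 (args2 0 y) c x x'.
by rewrite !upd_args2l.
Qed.

Lemma mlin2_bilinear (f : mlin U V 2) :
  bilinear_for (GRing.Scale.Law.clone _ _ *:%R _)
    (GRing.Scale.Law.clone _ _ *:%R _) (fun x y => f (args2 x y)).
Proof.
by split=> z c x y; [exact: mlin2_linearl | exact: mlin2_linearr].
Qed.

Fact mlin1_of_subproof (g : U -> V) :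
  linear g -> (fun a : 'I_1 -> U => g (a ord0)) \in multilinear.
Proof. by move=> gL; apply/multilinearP => l a c x y; rewrite !upd_args1 gL. Qed.

Definition mlin1_of g (gL : linear g) : mlin U V 1 := MLin (mlin1_of_subproof gL).

Fact mlin2_of_subproof (g : U -> U -> V) :
  (forall x, linear (g x)) -> (forall y, linear (g^~ y)) ->
  (fun a : 'I_2 -> U => g (a ord0) (a ord_max)) \in multilinear.
Proof.
move=> gr gl; apply/multilinearP => l a c x y; rewrite (args2E a).
have [->|->] : l = ord0 \/ l = ord_max.
  by case: l => -[|[|//]] l2; [left | right]; apply: val_inj.
- by rewrite !upd_args2l /= [LHS]gl.
- by rewrite !upd_args2r /= [LHS]gr.
Qed.

Definition mlin2_of g gr gl : mlin U V 2 := MLin (@mlin2_of_subproof g gr gl).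

End SmallArity.

(** * Sequences of linear maps extended by an entry of index 0 *)

Section ExtendedSequences.
Variables (K : fieldType) (N : nat).

(* The component d_0 of the twist vanishes, as d_0 = id on the extension. *)
Definition extd0 (V W : lmodType K) (d : 'I_N -> {linear V -> W})
    (i : 'I_N.+1) : {linear V -> W} :=
  if unlift ord0 i is Some k then d k else \0.

Lemma extd_ord0 (V : lmodType K) (d : 'I_N -> {linear V -> V}) x : extd d ord0 x = x.
Proof. by rewrite /extd unlift_none. Qed.

Lemma extd_lift (V : lmodType K) (d : 'I_N -> {linear V -> V}) k x :
  extd d (lift ord0 k) x = d k x.
Proof. by rewrite /extd liftK. Qed.

Lemma extd0_ord0 (V W : lmodType K) (d : 'I_N -> {linear V -> W}) x :
  extd0 d ord0 x = 0.
Proof. by rewrite /extd0 unlift_none. Qed.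

Lemma extd0_lift (V W : lmodType K) (d : 'I_N -> {linear V -> W}) k x :
  extd0 d (lift ord0 k) x = d k x.
Proof. by rewrite /extd0 liftK. Qed.

End ExtendedSequences.

(** * Products and maps d_k twisted by a 2-cochain *)

Section CocycleExtension.
Variables (K : fieldType) (N : nat) (A : assHDer K N) (M : representation A).
Implicit Types (c : cochain M 2) (a b : A) (m : M) (k : 'I_N).

Definition mulc c a b : M := c.1 (args2 a b).
Definition derc c k a : M := c.2 k (fun=> a).

Lemma mulc_bilinear c :
  bilinear_for (GRing.Scale.Law.clone _ _ *:%R _)
    (GRing.Scale.Law.clone _ _ *:%R _) (mulc c).
Proof. exact: mlin2_bilinear. Qed.

HB.instance Definition _ c :=
  bilinear_isBilinear.Build K A A M *:%R *:%R (mulc c) (mulc_bilinear c).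

HB.instance Definition _ c k :=
  GRing.isLinear.Build K A M _ (derc c k) (mlin1_linear (c.2 k)).

Definition ext_mul c (x y : A * M) : A * M :=
  (amul x.1 y.1, lact x.1 y.2 + ract x.2 y.1 + mulc c x.1 y.1).

Definition ext_der c k (x : A * M) : A * M :=
  (hder k x.1, rder M k x.2 + derc c k x.1).

Lemma ext_mul_bilinear c :
  bilinear_for (GRing.Scale.Law.clone _ _ *:%R _)
    (GRing.Scale.Law.clone _ _ *:%R _) (ext_mul c).
Proof.
have pairP e (x y : A * M) : e *: x + y = (e *: x.1 + y.1, e *: x.2 + y.2) by [].
split=> z e x y; rewrite !pairP /ext_mul /= !(linearPl, linearPr).
all: by rewrite !scalerDr addrACA3.
Qed.

HB.instance Definition _ c :=
  bilinear_isBilinear.Build K (A * M)%type (A * M)%type (A * M)%type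
    *:%R *:%R (ext_mul c) (ext_mul_bilinear c).

Lemma ext_der_linear c k : linear (ext_der c k).
Proof.
by move=> e x y; congr pair; rewrite /= !linearP // !scalerDr addrACA.
Qed.

HB.instance Definition _ c k :=
  GRing.isLinear.Build K (A * M)%type (A * M)%type _ (ext_der c k)
    (ext_der_linear c k).

(** * The differential of a 2-cochain, written out *)

Lemma dHoch2E c (u : 'I_3 -> A)
    (x := u ord0) (y := u (lift ord0 ord0)) (z := u ord_max) :
  dHoch c.1 u
  = lact x (mulc c y z) - mulc c (amul x y) z + mulc c x (amul y z)
    - ract (mulc c x y) z.
Proof.
rewrite /dHoch /= big_ord_recl big_ord1 /= !exprS expr0 mulr1 !mulN1r opprK.
rewrite scale1r !scaleN1r addrA.
have E (j j' : 'I_3) : j = j' :> nat -> u j = u j' by move=> /val_inj ->.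
congr (lact _ _ - _ + _ - ract _ _); rewrite /mulc; congr (c.1 _).
all: apply/funext => i; case: i => -[|[|//]] i2.
all: rewrite /args_tail /args_merge /args_init /args_tail /args2 -?val_eqE /=.
all: by first [exact: E | congr (amul _ _); exact: E].
Qed.

Lemma delta2E c k a b :
  delta k c.1 (args2 a b) =
    \sum_(i < N.+1) \sum_(j < N.+1 | (i + j == k.+1)%N)
      mulc c (extd hder i a) (extd hder j b) - rder M k (mulc c a b).
Proof.
rewrite /delta /=; congr (_ - _).
rewrite -(sum_ffun2 (fun i j : 'I_N.+1 => (i + j == k.+1)%N)).
apply: eq_big => [w|w _].
  rewrite big_ord_recl big_ord1.
  by congr (_ + nat_of_ord (w _) == _)%N; apply: val_inj.
by congr (c.1 _); rewrite [LHS]args2E.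
Qed.

(** Bundled as linear maps because [extd] and [extd0] take families of these. *)
Definition dercL c k : {linear A -> M} := derc c k.
Definition ext_derL c k : {linear (A * M)%type -> (A * M)%type} := ext_der c k.

(** Padding the family with a zero entry through [extd0] lets both sums of [dHoch'] run over the
    index set of the Leibniz rule, where they merge into one. *)
Lemma dHoch'1E c k a b :
  dHoch' c.2 k (args2 a b) =
    \sum_(i < N.+1) \sum_(j < N.+1 | (i + j == k.+1)%N)
      (lact (extd hder i a) (extd0 (dercL c) j b)
       + ract (extd0 (dercL c) i a) (extd hder j b))
    - derc c k (amul a b).
Proof.
rewrite /dHoch' /= big_ord1 !exprS expr0 mulr1 mulN1r opprK scale1r scaleN1r.
have tailE : args_tail (args2 a b) = fun=> b by apply/funext => j; rewrite ord1.
have initE : args_init (args2 a b) = fun=> a by apply/funext => j; rewrite ord1.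
have mergeE : args_merge ord0 (args2 a b) = fun=> amul a b.
  by apply/funext => j; rewrite (ord1 j) /args_merge /= initE tailE.
rewrite tailE initE mergeE addrAC; congr (_ - _).
under [RHS]eq_bigr => i _ do rewrite big_split /=.
rewrite big_split /=; congr (_ + _).
  (* The padded term [j = 0] vanishes; at [lift ord0 j] the condition becomes the one on [j.+1]. *)
  apply: eq_bigr => i _; rewrite [RHS]big_mkcond [LHS]big_mkcond big_ord_recl /=.
  rewrite extd0_ord0 linear0r if_same add0r.
  by apply: eq_bigr => j _; rewrite extd0_lift.
rewrite [RHS]big_ord_recl [X in _ = X + _]big1 ?add0r => [|j _]; last first.
  by rewrite extd0_ord0 linear0l.
by apply: eq_bigr => i _; apply: eq_bigr => j _; rewrite extd0_lift.
Qed.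

(** At index 0 both sides are [x], precisely because [extd0] is zero there. *)
Lemma extd_ext_der c i x :
  extd (ext_derL c) i x
  = (extd hder i x.1, extd (rder M) i x.2 + extd0 (dercL c) i x.1).
Proof.
have [k ->|->] := unliftP ord0 i; first by rewrite !extd_lift extd0_lift.
by rewrite !extd_ord0 extd0_ord0 addr0; case: x.
Qed.

(** * Cocycle equations as associativity and the Leibniz rule *)

Lemma cocycle2E c : c \in @cocycle K N A M 2 <->
  (forall u, dHoch c.1 u = 0) /\
  (forall k u, dHoch' c.2 k u + delta k c.1 u = 0).
Proof.
split=> [/eqP H|[H1 H2]].
  have H1 : dHoch c.1 = 0 := congr1 (fun d : cochain M 3 => d.1) H.
  have H2 : (diff c).2 = 0 := congr1 (fun d : cochain M 3 => d.2) H.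
  split=> [u|k u]; first by rewrite H1.
  have /ffunP/(_ k) := H2.
  (* The sign [(-1) ^+ 2] of degree 2 is 1. *)
  by rewrite !ffunE sqrrN expr1n scale1r => /mlin_eqP/(_ u).
apply/eqP; rewrite /diff; congr pair; first exact/mlin_eqP.
apply/ffunP => k; rewrite !ffunE sqrrN expr1n scale1r; apply/mlin_eqP => u.
exact: H2.
Qed.

(** The A-components hold by the axioms of [A]. In the M-components, the terms containing elements
    of [M] agree by the axioms of the representation, and what remains is the cocycle equation. *)
Lemma cocycle2P c : reflect
  (associative (ext_mul c) /\
   forall k x y, ext_der c k (ext_mul c x y) =
     \sum_(i < N.+1) \sum_(j < N.+1 | (i + j == k.+1)%N)
       ext_mul c (extd (ext_derL c) i x) (extd (ext_derL c) j y))
  (c \in @cocycle K N A M 2).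
Proof.
pose mulcocycle := forall x y z, lact x (mulc c y z) + mulc c x (amul y z)
    = mulc c (amul x y) z + ract (mulc c x y) z.
pose dercocycle := forall k a b,
   \sum_(i < N.+1) \sum_(j < N.+1 | (i + j == k.+1)%N)
      (lact (extd hder i a) (extd0 (dercL c) j b)
       + ract (extd0 (dercL c) i a) (extd hder j b)
       + mulc c (extd hder i a) (extd hder j b))
   = derc c k (amul a b) + rder M k (mulc c a b).
have cocE : c \in @cocycle K N A M 2 <-> mulcocycle /\ dercocycle.
  (* Both cocycle equations have this four-term shape, so one rearrangement gives their
     subtraction-free forms. *)
  have eq0 (u v w x : M) : (u - v + w - x == 0) = (u + w == v + x).
    by rewrite [u - v + w]addrAC -(addrA (u + w)) -opprD subr_eq0.
  split=> [/cocycle2E[H1 H2]|[H1 H2]];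
    [split=> [x y z|k a b] | apply/cocycle2E; split=> [u|k u]].
  - have := H1 (tnth [tuple x; y; z]); rewrite dHoch2E !(tnth_nth 0) /=.
    by move/eqP; rewrite eq0 => /eqP.
  - have /eqP := H2 k (args2 a b).
    by rewrite dHoch'1E delta2E addrA eq0 => /eqP <-; rewrite double_sumD.
  - rewrite dHoch2E; apply/eqP; rewrite eq0; exact/eqP/H1.
  - rewrite (args2E u) dHoch'1E delta2E; apply/eqP.
    rewrite addrA eq0 -double_sumD; exact/eqP/H2.
have assocE : associative (ext_mul c) <-> mulcocycle.
  split=> [H x y z|H [x m] [y n] [z p]].
    (* Arguments with zero M-component isolate the contribution of the twist. *)
    have := congr1 snd (H (x, 0) (y, 0) (z, 0)).
    by rewrite /= !(linear0r, linear0l, add0r, addr0) => ->; rewrite addrC.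
  rewrite /ext_mul /=; congr pair; first exact: amulA.
  rewrite !(linearDr, linearDl) lactM ractM lractA /=.
  rewrite -!addrA; do 2!congr (_ + _).
  by rewrite addrCA H addrA (addrC (mulc _ _ _)) addrA.
have extmulE (i j : 'I_N.+1) x y :
    ext_mul c (extd (ext_derL c) i x) (extd (ext_derL c) j y) =
    (amul (extd hder i x.1) (extd hder j y.1),
     lact (extd hder i x.1) (extd (rder M) j y.2)
     + ract (extd (rder M) i x.2) (extd hder j y.1)
     + (lact (extd hder i x.1) (extd0 (dercL c) j y.1)
        + ract (extd0 (dercL c) i x.1) (extd hder j y.1)
        + mulc c (extd hder i x.1) (extd hder j y.1))).
  rewrite !extd_ext_der /ext_mul /= linearDr linearDl /=.
  by rewrite addrACA -!addrA.
have extderE : dercocycle <-> forall k x y, ext_der c k (ext_mul c x y) =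
     \sum_(i < N.+1) \sum_(j < N.+1 | (i + j == k.+1)%N)
       ext_mul c (extd (ext_derL c) i x) (extd (ext_derL c) j y).
  have pairE (u v : A * M) : u.1 = v.1 -> u.2 = v.2 -> u = v.
    by case: u v => [? ?] [? ?] /= -> ->.
  split=> H k.
    move=> u v; apply: pairE; rewrite raddf_sum.
      rewrite /= hderP; apply: eq_bigr => i _.
      by rewrite raddf_sum; apply: eq_bigr => j _; rewrite extmulE.
    under [RHS]eq_bigr => i _ do
      (rewrite raddf_sum; under eq_bigr => j _ do rewrite extmulE /=).
    (* The first two sums are the Leibniz rules of the representation; the other three form the left
       side of [dercocycle]. *)
    rewrite !double_sumD -rder_lact -rder_ract -!double_sumD H.
    rewrite /= !linearD -!addrA.
    by do 2!congr (_ + _); rewrite addrC.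
  move=> a b; have := congr1 snd (H k (a, 0) (b, 0)).
  rewrite raddf_sum /=.
  under [X in _ = X -> _]eq_bigr => i _ do
    (rewrite raddf_sum; under eq_bigr => j _ do
       rewrite extmulE /= !(linear0, linear0l, linear0r, add0r)).
  by rewrite linear0l linear0r !add0r addrC.
by apply: (iffP idP); rewrite cocE assocE extderE.
Qed.

(** * The abelian extension attached to a 2-cocycle *)

Definition cocycle_alg c (cP : c \in @cocycle K N A M 2) : assAlg K :=
  @AssAlg K (A * M)%type (ext_mul c) (elimT (cocycle2P c) cP).1.

Definition cocycle_pair c (cP : c \in @cocycle K N A M 2) : assHDer K N :=
  @AssHDer K N (cocycle_alg cP) (ext_derL c) (elimT (cocycle2P c) cP).2.

Definition cocycle_incl m : A * M := (0, m).

Lemma cocycle_incl_linear : linear cocycle_incl.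
Proof. by move=> e x y; congr pair; rewrite /= scaler0 addr0. Qed.

HB.instance Definition _ :=
  GRing.isLinear.Build K M (A * M)%type _ cocycle_incl cocycle_incl_linear.

Definition cocycle_section a : A * M := (a, 0).

Lemma cocycle_section_linear : linear cocycle_section.
Proof. by move=> e x y; congr pair; rewrite /= scaler0 addr0. Qed.

HB.instance Definition _ :=
  GRing.isLinear.Build K A (A * M)%type _ cocycle_section cocycle_section_linear.

Section CocycleRepExtension.
Variables (c : cochain M 2) (cP : c \in @cocycle K N A M 2).

Fact cocycle_incl_mul m m' :
  cocycle_incl (zero_mul m m') = ext_mul c (cocycle_incl m) (cocycle_incl m').
Proof. by congr pair; rewrite /= !(linear0l, linear0r) // !addr0. Qed.

Fact cocycle_incl_hder k m :
  cocycle_incl (rder M k m) = ext_der c k (cocycle_incl m).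
Proof. by congr pair; rewrite /= !linear0 // addr0. Qed.

Definition cocycle_i :
    assHDer_morphism (zero_assHDer (rder M)) (cocycle_pair cP) :=
  @AssHDerMorphism K N (zero_assHDer (rder M)) (cocycle_pair cP)
    cocycle_incl cocycle_incl_mul cocycle_incl_hder.

Definition cocycle_p : assHDer_morphism (cocycle_pair cP) A :=
  @AssHDerMorphism K N (cocycle_pair cP) A fst
    (fun _ _ => erefl) (fun _ _ => erefl).

(** Closed with [Defined] so that its inclusion, projection and section compute later on. *)
Definition cocycle_extension : abelian_extension A (rder M).
Proof.
apply: (@AbelianExtension K N A M (rder M) (cocycle_pair cP) cocycle_i cocycle_p
  _ _ _ cocycle_section _).
- by move=> m m' [].
- case=> a m /=; split=> [->|[m' [-> _]] //]; by exists m.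
- by move=> a; exists (a, 0).
- by [].
Defined.

Fact cocycle_induces_rep : induces_rep cocycle_extension.
Proof.
by split=> *; congr pair; rewrite /= ?(linear0l, linear0r) // !(add0r, addr0).
Qed.

Definition cocycle_rep_extension : rep_extension M :=
  RepExtension cocycle_induces_rep.

End CocycleRepExtension.

(** * Equivalences of twists and coboundaries *)

(** An equivalence fixes [M] and lies over [A], so it is determined by the M-component [g] of its
    values on the section. The two conditions are the M-components of its compatibility with
    products and with the d_k. *)
Lemma cocycle_ext_equivalentP c c' cP c'P :
  ext_equivalent (@cocycle_rep_extension c cP) (@cocycle_rep_extension c' c'P)
  <-> exists g : {linear A -> M},
    (forall a b, mulc c a b + g (amul a b) =
      lact a (g b) + ract (g a) b + mulc c' a b) /\
    (forall k a, derc c k a + g (hder k a) = rder M k (g a) + derc c' k a).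
Proof.
split=> [[Psi [Psi_i Psi_p]]|[g [gM gd]]].
  pose g0 a : M := (Psi (cocycle_section a)).2.
  have g_lin : linear g0 by move=> e x y; rewrite /g0 !linearP.
  pose g : {linear A -> M} := HB.pack g0 (GRing.isLinear.Build K A M _ g0 g_lin).
  have PsiE x : Psi x = (x.1, x.2 + g x.1).
    have -> : x = cocycle_section x.1 + cocycle_incl x.2.
      by case: x => a m; congr pair; rewrite /= ?addr0 ?add0r.
    rewrite linearD Psi_i /=; congr pair; rewrite ?addr0 /=.
      exact: Psi_p.
    by rewrite add0r addrC.
  exists g; split=> [a b|k a].
    have := congr1 snd (morphM Psi (cocycle_section a) (cocycle_section b)).
    by rewrite !PsiE /= !(linear0l, linear0r, add0r).
  have := congr1 snd (morph_hder Psi k (cocycle_section a)).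
  by rewrite !PsiE /= !(linear0, add0r).
pose Psi0 (x : A * M) : A * M := (x.1, x.2 + g x.1).
have Psi_lin : linear Psi0.
  by move=> e x y; congr pair; rewrite /= linearP scalerDr addrACA.
pose PsiL : {linear (A * M)%type -> (A * M)%type} :=
  HB.pack Psi0 (GRing.isLinear.Build K (A * M)%type (A * M)%type _ Psi0 Psi_lin).
have PsiM x y : PsiL (ext_mul c x y) = ext_mul c' (PsiL x) (PsiL y).
  congr pair; rewrite /= -[LHS]addrA gM linearDr linearDl /=.
  by rewrite [LHS]addrA; congr (_ + _); exact: addrACA.
have Psid k x : PsiL (ext_der c k x) = ext_der c' k (PsiL x).
  by congr pair; rewrite /= -[LHS]addrA gd linearD addrA.
exists (@AssHDerMorphism K N (cocycle_pair cP) (cocycle_pair c'P) PsiL PsiM Psid).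
by split=> // m; congr pair; rewrite /= (linear0 g) addr0.
Qed.

(** A one-entry tuple of weight [k.+1] has the single entry [lift ord0 k], so the sum has one
    term. *)
Lemma delta1E (g : mlin A M 1) k a :
  delta k g (fun=> a) = g (fun=> hder k a) - rder M k (g (fun=> a)).
Proof.
rewrite /delta /=; congr (_ - _).
rewrite -(extd_lift hder k a).
rewrite (eq_bigl (fun w : {ffun 'I_1 -> 'I_N.+1} => w ord0 == lift ord0 k)); last first.
  by move=> w; rewrite big_ord1.
under eq_bigr => w _ do rewrite [X in g X]args1E.
rewrite (sum_ffun1 (pred1 (lift ord0 k)) (fun i => g (fun=> extd hder i a))).
exact: big_pred1_eq.
Qed.

Lemma dHoch1E (g : mlin A M 1) a b :
  dHoch g (args2 a b) = lact a (g (fun=> b)) - g (fun=> amul a b)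
    + ract (g (fun=> a)) b.
Proof.
rewrite /dHoch /= big_ord1 !exprS expr0 mulr1 mulN1r opprK scale1r scaleN1r.
by congr (lact _ (g _) - g _ + ract (g _) _); apply/funext => j; rewrite (ord1 j).
Qed.

(** Restates coboundaries with linear maps instead of [mlin] of arity 1, to match
    [cocycle_ext_equivalentP]. The minus sign before [delta] in degree 1 puts [rder] first in the
    second equation. *)
Lemma coboundary2P (z : cocycles M 2) : z \in @coboundary K N A M 2 <->
  exists g : {linear A -> M},
    (forall a b, mulc (val z) a b = lact a (g b) - g (amul a b) + ract (g a) b) /\
    (forall k a, derc (val z) k a = rder M k (g a) - g (hder k a)).
Proof.
have diffE (f : mlin A M 1) : val z = @diff K N A M 1 f <->
    (forall a b, mulc (val z) a b = lact a (f (fun=> b)) - f (fun=> amul a b)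
       + ract (f (fun=> a)) b) /\
    (forall k a, derc (val z) k a = rder M k (f (fun=> a)) - f (fun=> hder k a)).
  split=> [E|[E1 E2]].
    split=> [a b|k a]; rewrite /mulc /derc E; first exact: dHoch1E.
    by rewrite ffunE -[LHS]/(- delta k f (fun=> a)) delta1E opprB.
  move: E1 E2; case: (val z) => c1 c2 E1 E2; congr pair.
    by apply/mlin_eqP => u; rewrite (args2E u) dHoch1E -E1.
  apply/ffunP => k; apply/mlin_eqP => u; rewrite (args1E u) ffunE.
  by rewrite -[RHS]/(- delta k f (fun=> _)) delta1E opprB -E2.
split=> [/asboolP[f /diffE[f1 f2]]|[g [g1 g2]]].
  pose g0 a : M := f (fun=> a).
  pose g : {linear A -> M} :=
    HB.pack g0 (GRing.isLinear.Build K A M _ g0 (mlin1_linear f)).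
  by exists g.
apply/asboolP; exists (mlin1_of (linearP g)); exact/diffE.
Qed.

(** * Every extension is equivalent to a twist *)

(** The cocycle equations need no direct computation: [Psi] is injective and intertwines the
    operations, so associativity and the Leibniz rule pull back from [E], and [cocycle2P]
    applies. *)
Lemma cocycle_ext_surj (E : rep_extension M) :
  exists c (cP : c \in @cocycle K N A M 2),
    ext_equivalent (cocycle_rep_extension cP) E.
Proof.
pose i := ext_i E; pose p := ext_p E; pose s := ext_s E.
have [il ir] := rep_extP E; rewrite -/i -/s in il ir.
have ps a : p (s a) = a by exact: ext_sK.
have i_inj : injective i := @ext_i_inj _ _ _ _ _ E.
(* A chosen inverse of [i] on the kernel of [p]; its value 0 elsewhere is a dummy. *)
have [r rK] : {r : E -> M & forall e, p e = 0 -> i (r e) = e}.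
  apply: (@choice E M (fun e m => p e = 0 -> i m = e)) => e.
  case: (pselect (p e = 0)) => [/ext_exact[m ->]|pe].
    by exists m.
  by exists 0.
pose f a b := r (amul (s a) (s b) - s (amul a b)).
pose h k a := r (hder k (s a) - s (hder k a)).
have fE a b : i (f a b) = amul (s a) (s b) - s (amul a b).
  by apply: rK; rewrite linearB /= morphM !ps subrr.
have hE k a : i (h k a) = hder k (s a) - s (hder k a).
  by apply: rK; rewrite linearB /= morph_hder !ps subrr.
have f_linr a : linear (f a).
  move=> e x y; apply: i_inj; rewrite (linearP i) !fE !(linearPr, linearP).
  by rewrite addrACA -scalerDr.
have f_linl b : linear (f^~ b).
  move=> e x y; apply: i_inj; rewrite (linearP i) !fE !(linearPl, linearP).
  by rewrite addrACA -scalerDr.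
have h_lin k : linear (h k).
  move=> e x y; apply: i_inj; rewrite (linearP i) !hE !linearP.
  by rewrite addrACA -scalerDr.
pose c : cochain M 2 := (mlin2_of f_linr f_linl, [ffun k => mlin1_of (h_lin k)]).
have mulcE a b : mulc c a b = f a b by [].
have dercE k a : derc c k a = h k a by rewrite /derc ffunE.
pose Psi0 (x : A * M) : E := s x.1 + i x.2.
have Psi_lin : linear Psi0.
  by move=> e x y; rewrite /Psi0 !linearP scalerDr addrACA.
pose Psi : {linear (A * M)%type -> E} :=
  HB.pack Psi0 (GRing.isLinear.Build K (A * M)%type E _ Psi0 Psi_lin).
have Psi_inj : injective Psi.
  move=> [a m] [b n] H; have ab : a = b.
    have := congr1 p H; rewrite /Psi /= /Psi0 !linearD /= !ps.
    have pi m' : p (i m') = 0 by apply/ext_exact; exists m'.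
    by rewrite !pi !addr0.
  by move: H; rewrite /Psi /= /Psi0 /= ab => /addrI/i_inj ->.
have PsiM x y : Psi (ext_mul c x y) = amul (Psi x) (Psi y).
  (* [i] is multiplicative and the product on [M] is zero. *)
  have ii : amul (i x.2) (i y.2) = 0.
    by rewrite -(morphM i) [X in i X = _](_ : _ = 0) ?linear0.
  rewrite /Psi /= /Psi0 /= !linearD /= il ir mulcE fE.
  rewrite !linearDl /= ii addr0.
  by rewrite [LHS]addrC -addrA subrK [LHS]addrC [X in _ + X]addrC addrA.
have Psid k x : Psi (ext_der c k x) = hder k (Psi x).
  have id : i (rder M k x.2) = hder k (i x.2) := morph_hder i k x.2.
  rewrite /Psi /= /Psi0 /= dercE !linearD /= hE id.
  by rewrite [LHS]addrC -addrA subrK addrC.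
have PsiD (j : 'I_N.+1) x : Psi (extd (ext_derL c) j x) = extd hder j (Psi x).
  have [k ->|->] := unliftP ord0 j; first by rewrite !extd_lift Psid.
  by rewrite !extd_ord0.
have cP : c \in @cocycle K N A M 2.
  apply/cocycle2P; split=> [x y z|k x y]; apply: Psi_inj.
    by rewrite !PsiM amulA.
  rewrite Psid PsiM hderP raddf_sum; apply: eq_bigr => j _.
  by rewrite raddf_sum; apply: eq_bigr => j' _; rewrite [RHS]PsiM !PsiD.
exists c, cP, (@AssHDerMorphism K N (cocycle_pair cP) E Psi PsiM Psid).
split=> [m|[a m]] /=; rewrite /Psi0 /= ?linear0 ?add0r //.
have pi m' : p (i m') = 0 by apply/ext_exact; exists m'.
by rewrite -/p linearD /= pi ps addr0.
Qed.

End CocycleExtension.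

(** * The bijection between cohomology classes and classes of extensions *)

Theorem theorem5p3 (K : fieldType) (N : nat)
    (charK : [pchar K] =i pred0) (N_gt0 : (0 < N)%N)
    (A : assHDer K N) (M : representation A) :
  exists Phi : cohomology M 2 -> Ext M, bijective Phi.
Proof.
pose Ec (z : cocycles M 2) := cocycle_rep_extension (cocyclesP z).
have EcP z z' : ext_equivalent (Ec z) (Ec z') <-> (z - z' \in @coboundary K N A M 2).
  rewrite cocycle_ext_equivalentP coboundary2P.
  have mulB a b : mulc (val (z - z')) a b = mulc (val z) a b - mulc (val z') a b by [].
  have derB k a : derc (val (z - z')) k a = derc (val z) k a - derc (val z') k a.
    by rewrite /derc /= !ffunE.
  (* Serves both equations; the one for the d_k is padded with [r = 0]. *)
  have subE (u u' l r : M) (w : M) : (u - u' == l - w + r) = (u + w == l + r + u').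
    by rewrite subr_eq (addrAC l) (addrAC (l + r)) eq_sym subr_eq eq_sym.
  split=> -[g [gM gd]]; exists g; split=> [a b|k a].
  - by rewrite mulB; apply/eqP; rewrite subE gM.
  - by rewrite derB; apply/eqP; rewrite -[X in _ == X]addr0 subE addr0 gd.
  - by apply/eqP; rewrite -subE -mulB gM.
  - by apply/eqP; rewrite -[rder M k _]addr0 -subE addr0 -derB gd.
(* Choosing [repr q] makes [Phi] a function at once; independence of the representative, from [EcP],
   enters in the surjectivity. *)
pose Phi (q : cohomology M 2) : Ext M :=
  @ExtClass K N A M (ext_equivalent (Ec (repr q))) (ex_intro _ _ erefl).
have Phi_inj q q' : Phi q = Phi q' -> q = q'.
  move=> eqq; rewrite -[q]reprK -[q']reprK; apply/eqP.
  rewrite -Quotient.idealrBE -EcP.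
  have -> : ext_equivalent (Ec (repr q)) = ext_equivalent (Ec (repr q')).
    exact: (f_equal (@ext_class K N A M) eqq).
  exact: ext_equivalent_refl.
have Phi_surj C : exists q, Phi q = C.
  case: C => C CP; have [E CE] := CP.
  have [c [cP cE]] := cocycle_ext_surj E.
  pose z := Cocycles cP.
  exists (\pi_(cohomology M 2)%qT z).
  have zE : ext_equivalent (Ec (repr (\pi_(cohomology M 2)%qT z))) (Ec z).
    by apply/EcP; rewrite Quotient.idealrBE reprK.
  have eqC : ext_equivalent (Ec (repr (\pi_(cohomology M 2)%qT z))) = C.
    (* Classes are predicates, hence equal once they hold for the same extensions. *)
    rewrite CE predeqE => F; split=> H.
      apply: ext_equivalent_trans H; apply: ext_equivalent_sym.
      exact: ext_equivalent_trans cE.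
    by apply: ext_equivalent_trans H; apply: ext_equivalent_trans cE.
  (* Two elements of [Ext] with the same predicate differ only in a proof. *)
  move: CP; rewrite /Phi -eqC => CP; congr ExtClass; exact: Prop_irrelevance.
have [g gK] := choice Phi_surj.
exists Phi; exists g => // q; exact/Phi_inj/gK.
Qed.
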